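(* Let $G$ be a graph with $n$ nodes and node connectivity $k$ with $k=\omega(\log n)$, and let $n_c$ be the number of available colors. If each node of $G$ is independently assigned a color chosen uniformly at random among the $n_c$ colors, then with high probability the value of the minimum color node cut of $G$ is $\Theta(\min(k,n_c))$. If, in addition, $k=\omega(n_c)$, then for any constant $\epsilon>0$, with high probability the value of the minimum color node cut of $G$ is at least $(1-\epsilon)n_c$.
   Context: Asymptotics are as $n\to\infty$ (with $k=k(n)$, $n_c=n_c(n)$), and ''with high probability'' means with probability $1-o(1)$. A node cut of a graph is a set of nodes whose removal either leaves more than one connected component or leaves exactly one node; node connectivity is the minimum size of a node cut. In a colored graph (each node carries one color), a color node cut is a set $C_c$ of colors such that the nodes whose colors lie in $C_c$ contain a node cut; the value of the minimum color node cut is the minimum size of a color node cut. *)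

(* Defs.v *)
From HB Require Import structures.
From mathcomp Require Import all_boot all_order all_algebra.
From mathcomp Require Import all_classical all_reals all_analysis.
Set Implicit Arguments.
Unset Strict Implicit.
Unset Printing Implicit Defensive.
Import Order.TTheory GRing.Theory Num.Theory.
Import numFieldNormedType.Exports.
Local Open Scope classical_set_scope.
Local Open Scope ring_scope.

Record sgraph (V : finType) := SGraph {
  adj :> rel V;
  adj_sym : symmetric adj;
  adj_irr : irreflexive adj }.

Section NodeCut.
Variables (V : finType) (G : sgraph V).

Definition adj_minus (S : {set V}) : rel V :=
  [rel x y | [&& G x y, x \notin S & y \notin S]].

(* ~: S is closed under adj_minus S, so n_comp counts the connected
   components of G - S. *)
Definition node_cut (S : {set V}) : bool :=
  (1 < n_comp (adj_minus S) (~: S))%N || (#|~: S| == 1)%N.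

(* The default value #|V| never matters when V is nonempty: removing all nodes
   but one is then a node cut, of size #|V| - 1. *)
Definition node_connectivity : nat :=
  \big[minn/#|V|]_(S : {set V} | node_cut S) #|S|.

End NodeCut.

Section ColorCut.
Variables (V : finType) (G : sgraph V) (nc : nat) (col : {ffun V -> 'I_nc}).

Definition color_node_cut (C : {set 'I_nc}) : bool :=
  [exists S : {set V}, node_cut G S && (S \subset col @^-1: C)%SET].

(* The default value nc is the size of the set of all colors, which is a color
   node cut when V is nonempty. *)
Definition min_color_node_cut : nat :=
  \big[minn/nc]_(C : {set 'I_nc} | color_node_cut C) #|C|.

End ColorCut.

(* Probability of A when the colors of the nodes are independent and uniform
   on 'I_nc: the law is the product of the uniform laws over the nodes. *)
Definition color_prob (R : realType) (V : finType) (nc : nat)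
    (A : pred {ffun V -> 'I_nc}) : R :=
  \sum_(col : {ffun V -> 'I_nc} | A col) \prod_(v : V) (nc%:R)^-1.

Definition whp (R : realType) (nc : nat -> nat)
    (A : forall n, pred {ffun 'I_n -> 'I_(nc n)}) : Prop :=
  color_prob R (A n) @[n --> \oo] --> (1 : R).

Definition little_omega (R : realType) (f g : nat -> R) : Prop :=
  g =o_\oo f.

(* Main.v *)
Require Import Defs.
From mathcomp Require Import all_boot all_order all_algebra.
From mathcomp Require Import all_classical all_reals all_analysis.
(* Repeated so that the finite-set names take precedence over the classical ones. *)
From mathcomp Require Import fintype fingraph finset zify ring lra.
Import Order.TTheory GRing.Theory Num.Theory.
Import numFieldNormedType.Exports.

Set Implicit Arguments.
Unset Strict Implicit.
Unset Printing Implicit Defensive.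

(** Keep every vertex independently with probability [p], let [W] be the set of
    kept vertices, and let [F W] count the components of the subgraph induced by
    [W] plus the vertices outside [W] that have no neighbor in [W]; call both
    kinds clusters. [F] decreases when [W] grows, and adding a vertex that
    touches [a] clusters lowers it by at least [a - 1]. A vertex [x] outside [W]
    is a bridge of a cluster [b] if it touches [b] and another cluster; it is a
    prebridge of [b] if [b] is the only cluster it touches and [x] has a neighbor
    [y] outside [W] not touching [b], so that [y] is a bridge of [x |: b] for
    [x |: W]. If [F W >= 2], the bridges and prebridges of a cluster separate it
    from another one, so there are at least [k] of them. The vertex [x] is the
    only neighbor of [y] in [x |: b], so the map
    [(W, b, x) |-> (x |: W, x |: b, y)] is injective, and prebridges are in
    expectation at most [(1 - p) / p] times as numerous as bridges. Hence the
    expected number of (cluster, bridge) pairs is at least [p k E(F - 1)], and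
    differentiating in [p] gives [d/dp E(F - 1) <= - (p k / 2) E(F - 1)],
    i.e. [E(F - 1) <= n exp (- k p^2 / 4)].

    The vertices whose color avoids a set [T] of colors form such a random set
    with [p = 1 - #|T| / nc], and if [T] is a color node cut then [F W >= 2] or
    [#|W| <= 1]. A union bound over all [T] gives the second claim. For the lower
    bound of the first one, the colors are grouped into [min(nc, k / 32)] nearly
    equal classes and the union bound runs over sets of classes. *)

(** * Minima over finite families, with a default value *)

Lemma bigminn_le (I : finType) (P : pred I) (F : I -> nat) (d : nat) (j : I) :
  P j -> \big[minn/d]_(i | P i) F i <= F j.
Proof.
move=> Pj; have : j \in index_enum I by rewrite mem_index_enum.
elim: (index_enum I) => // i r IH; rewrite in_cons big_cons => /orP[/eqP<-|/IH H].
  by rewrite Pj geq_minl.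
by case: ifP => // _; apply: leq_trans H; exact: geq_minr.
Qed.

Lemma bigminn_le_default (I : finType) (P : pred I) (F : I -> nat) (d : nat) :
  \big[minn/d]_(i | P i) F i <= d.
Proof. by elim/big_rec: _ => // i m _ H; rewrite geq_min H orbT. Qed.

Lemma bigminn_attained (I : finType) (P : pred I) (F : I -> nat) (d : nat) :
  \big[minn/d]_(i | P i) F i < d ->
  exists2 i, P i & F i = \big[minn/d]_(i | P i) F i.
Proof.
elim/big_rec: _ => [|i m Pi IH]; first by rewrite ltnn.
case: (leqP (F i) m) => [Fm _|mF /IH//].
by exists i.
Qed.

(** * Node cuts, connectivity and separators *)

Section Cut.
Variables (V : finType) (G : sgraph V).
Implicit Types (S A W b : {set V}) (x y z u : V).

Lemma connect_adj_minus_sym S : connect_sym (adj_minus G S).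
Proof.
apply: sym_connect_sym => x y; rewrite /adj_minus /= adj_sym.
by case: (x \in S); case: (y \in S).
Qed.

Lemma connect_stable (e : rel V) A x y :
  (forall s t, s \in A -> e s t -> t \in A) ->
  x \in A -> connect e x y -> y \in A.
Proof.
move=> clA xA /connectP[p pth ->]; elim: p x xA pth => //= t p IH x xA /andP[xt].
by apply: IH; exact: clA xt.
Qed.

Lemma node_cut_disconnected S x y : x \notin S -> y \notin S ->
  ~~ connect (adj_minus G S) x y -> node_cut G S.
Proof.
move=> xS yS nc; apply/orP; left; apply/card_gt1P.
have symS := connect_adj_minus_sym S.
have cl z : z \notin S -> root (adj_minus G S) z \notin S.
  move=> zS; rewrite -in_setC.
  apply: (@connect_stable _ _ z) (connect_root _ z); last by rewrite inE.
  by move=> s t _ /and3P[_ _]; rewrite inE.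
exists (root (adj_minus G S) x), (root (adj_minus G S) y); split.
- by rewrite !inE (roots_root symS) cl.
- by rewrite !inE (roots_root symS) cl.
- by rewrite (root_connect symS).
Qed.

Lemma node_cut_inv S : node_cut G S ->
  (exists x y, [/\ x \notin S, y \notin S & ~~ connect (adj_minus G S) x y])
  \/ #|~: S| = 1.
Proof.
case/orP => [/card_gt1P[x [y []]]|/eqP]; last by right.
rewrite !inE => /andP[/eqP rx xS] /andP[/eqP ry yS] nxy; left; exists x, y.
by split => //; rewrite -(root_connect (connect_adj_minus_sym S)) rx ry.
Qed.

Lemma node_connectivity_le S : node_cut G S -> node_connectivity G <= #|S|.
Proof. exact: bigminn_le. Qed.

Lemma node_connectivity_separator A S x z :
  x \in A -> [disjoint A & S] -> z \notin A -> z \notin S ->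
  (forall s t, s \in A -> G s t -> t \in A :|: S) ->
  node_connectivity G <= #|S|.
Proof.
move=> xA dAS zA zS NA; apply: node_connectivity_le.
apply: (@node_cut_disconnected S x z) => //; first by rewrite (disjointFr dAS xA).
apply: contra zA; apply: connect_stable => // s t sA /and3P[st _ tS].
by have := NA _ _ sA st; rewrite inE (negbTE tS) orbF.
Qed.

(** The neighborhood of [u] separates [u] from any non-neighbor; if there is none, removing it
    leaves [u] alone, the second kind of node cut. *)
Lemma node_connectivity_le_degree u : node_connectivity G <= #|[set x | G u x]|.
Proof.
case: (pickP [pred z | (z != u) && ~~ G u z]) => [z /andP[zu nuz]|H].
  apply: (@node_connectivity_separator [set u] _ u z); rewrite ?inE //.
  - by rewrite disjoints1 inE adj_irr.
  - by move=> s t; rewrite !inE => /eqP-> ->; rewrite orbT.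
apply: node_connectivity_le; apply/orP; right.
suff -> : ~: [set x | G u x] = [set u] by rewrite cards1.
apply/setP => z; rewrite !inE; move: (H z) => /=.
by case: eqVneq => [->|_] /=; [rewrite adj_irr|move/negbFE ->].
Qed.

Lemma node_cutC1 u : node_cut G (~: [set u]).
Proof. by rewrite /node_cut setCK cards1 orbT. Qed.

Lemma node_connectivity_ltn u : node_connectivity G < #|V|.
Proof.
apply: leq_ltn_trans (node_connectivity_le (node_cutC1 u)) _.
by rewrite cardsC1 ltn_predL; apply/card_gt0P; exists u.
Qed.

Lemma node_connectivity_attained u :
  exists2 S, node_cut G S & #|S| = node_connectivity G.
Proof. exact: bigminn_attained (node_connectivity_ltn u). Qed.

(** * Clusters, bridges and prebridges of a vertex set *)

Definition cluster W x : {set V} := [set y | connect (adj_minus G (~: W)) x y].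

Definition anchors W : {set V} :=
  [set x | (x \in W) || [forall y, (y \in W) ==> ~~ G x y]].

(* The components of the subgraph induced by [W], together with a singleton for
   each vertex outside [W] that has no neighbor in [W]. *)
Definition clusters W : {set {set V}} := [set cluster W x | x in anchors W].

(** The case [y == x] lets a vertex outside [W] without neighbors in [W] touch its own singleton, so
    every vertex touches some cluster. *)
Definition touched W x : {set {set V}} :=
  [set b in clusters W | [exists y in b, (y == x) || G x y]].

Definition bridges W b : {set V} :=
  [set x | [&& x \notin W, b \in touched W x & 1 < #|touched W x|]].

(* Adding such an [x] to [W] makes [y] a bridge of [x |: b]. *)
Definition prebridge_via W b x y :=
  [&& y \notin W, G x y & b \notin touched W y].

Definition prebridges W b : {set V} :=
  [set x | [&& x \notin W, b \subset W, touched W x == [set b] &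
             [exists y, prebridge_via W b x y]]].

Lemma adj_minusC W x y :
  adj_minus G (~: W) x y = [&& G x y, x \in W & y \in W].
Proof. by rewrite /adj_minus /= !inE !negbK. Qed.

Lemma mem_cluster W x : x \in cluster W x.
Proof. by rewrite inE connect0. Qed.

Lemma cluster_out W x : x \notin W -> cluster W x = [set x].
Proof.
move=> xW; apply/setP => y; rewrite !inE; apply/idP/eqP => [|->]; last exact: connect0.
move=> c; apply/set1P; apply: connect_stable c; last by rewrite inE.
by move=> s t /set1P ->; rewrite adj_minusC (negbTE xW) andbF.
Qed.

Lemma cluster_subset W x : x \in W -> cluster W x \subset W.
Proof.
move=> xW; apply/subsetP => y; rewrite inE; apply: connect_stable => // s t _.
by rewrite adj_minusC => /and3P[].
Qed.

Lemma eq_cluster W x y : y \in cluster W x -> cluster W x = cluster W y.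
Proof.
rewrite inE => c; apply/setP => z; rewrite !inE.
exact: same_connect (connect_adj_minus_sym _) _ _ c z.
Qed.

Lemma clusters_eq W b x : b \in clusters W -> x \in b -> b = cluster W x.
Proof. by case/imsetP => z _ ->; exact: eq_cluster. Qed.

Lemma clusters_sub_or_singleton W b : b \in clusters W ->
  (b \subset W /\ exists x, x \in b) \/
  (exists u, [/\ b = [set u], u \notin W & forall y, y \in W -> ~~ G u y]).
Proof.
case/imsetP => x; rewrite inE => xA ->; case: (boolP (x \in W)) => xW.
  by left; rewrite cluster_subset //; split => //; exists x; exact: mem_cluster.
right; exists x; rewrite cluster_out //; split => // y yW.
by move: xA; rewrite (negbTE xW) /= => /forallP/(_ y); rewrite yW.
Qed.

Lemma cluster_step W x y z : y \in cluster W x -> y \in W -> z \in W -> G y z ->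
  z \in cluster W x.
Proof.
rewrite !inE => xy yW zW yz; apply: connect_trans xy _; apply: connect1.
by rewrite adj_minusC yz yW.
Qed.

Lemma clusters_in W x : x \in W -> cluster W x \in clusters W.
Proof. by move=> xW; apply: imset_f; rewrite inE xW. Qed.

Lemma touched_self W x : x \in anchors W -> cluster W x \in touched W x.
Proof.
move=> xA; rewrite inE imset_f //=; apply/existsP; exists x.
by rewrite mem_cluster eqxx.
Qed.

Lemma touched_adj W x y : y \in anchors W -> G x y -> cluster W y \in touched W x.
Proof.
move=> yA xy; rewrite inE imset_f //=; apply/existsP; exists y.
by rewrite mem_cluster xy orbT.
Qed.

Lemma touched_gt0 W x : 0 < #|touched W x|.
Proof.
apply/card_gt0P; case: (boolP (x \in anchors W)) => [/touched_self ?|].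
  by exists (cluster W x).
rewrite inE negb_or => /andP[xW /forallPn[y]]; rewrite negb_imply negbK.
move=> /andP[yW xy]; exists (cluster W y); apply: touched_adj => //.
by rewrite inE yW.
Qed.

Lemma cluster_addE W x z : x \notin cluster (x |: W) z ->
  cluster (x |: W) z = cluster W z.
Proof.
move=> xz; apply/eqP; rewrite eqEsubset; apply/andP; split; last first.
  apply/subsetP => y; rewrite !inE; apply: connect_sub => s t.
  rewrite adj_minusC => /and3P[st sW tW]; apply: connect1.
  by rewrite adj_minusC st !inE sW tW !orbT.
apply/subsetP => y; rewrite inE => c.
suff: y \in cluster W z :&: cluster (x |: W) z by case/setIP.
apply: connect_stable c; last by rewrite inE !mem_cluster.
move=> s t /setIP[sz sz']; rewrite adj_minusC => /and3P[st sW' tW'].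
have tz' : t \in cluster (x |: W) z by exact: cluster_step sz' sW' tW' st.
have tx : t != x by apply: contraNneq xz => E; rewrite -[X in X \in _]E.
have sx : s != x by apply: contraNneq xz => E; rewrite -[X in X \in _]E.
rewrite inE tz' andbT; apply: cluster_step sz _ _ st.
  by move: sW'; rewrite !inE (negbTE sx).
by move: tW'; rewrite !inE (negbTE tx).
Qed.

(** Adding [x] merges the clusters it touches into its own; a cluster of [x |: W] without [x] was
    there before and is not touched by [x]. *)
Lemma clusters_add W x : x \notin W ->
  clusters (x |: W) \subset
    cluster (x |: W) x |: (clusters W :\: touched W x).
Proof.
move=> xW; apply/subsetP => b /imsetP[z zA ->].
rewrite in_setU1; case: (boolP (x \in cluster (x |: W) z)) => xz.
  by rewrite (eq_cluster xz) eqxx.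
apply/orP; right; have bE := cluster_addE xz; rewrite bE.
have zx : z != x by apply: contraNneq xz => ->; exact: mem_cluster.
have xb : x \notin cluster W z by rewrite -bE.
have zAW : z \in anchors W.
  move: zA; rewrite !inE (negbTE zx) /= => /orP[->//|/forallP H].
  apply/orP; right; apply/forallP => y; apply/implyP => yW.
  by have := H y; rewrite !inE yW orbT.
rewrite in_setD imset_f // andbT inE negb_and; apply/orP; right.
apply/existsPn => y; rewrite negb_and -implybE; apply/implyP => yb.
rewrite negb_or; apply/andP; split.
  by apply: contraNneq xb => <-.
apply/negP => xy; case: (boolP (z \in W)) => zW.
  have yW : y \in W by exact: (subsetP (cluster_subset zW)).
  move/negP: xz; apply; apply: (@cluster_step _ z y x).
  - by rewrite bE.
  - by rewrite !inE yW orbT.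
  - by rewrite !inE eqxx.
  - by rewrite adj_sym.
(* Here the cluster is the singleton of [z], an anchor of [x |: W] outside that set, so [z] is not
   adjacent to [x]. *)
move: yb; rewrite cluster_out // inE => /eqP yz; subst y.
move: zA; rewrite !inE (negbTE zx) (negbTE zW) /= => /forallP/(_ x).
by rewrite !inE eqxx /= adj_sym xy.
Qed.

Lemma card_clusters_add W x : x \notin W ->
  #|clusters (x |: W)| + #|touched W x| <= (#|clusters W|).+1.
Proof.
move=> xW; have sT : touched W x \subset clusters W.
  by apply/subsetP => b; rewrite inE => /andP[].
have := subset_leq_card (clusters_add xW); rewrite cardsU1 => H.
have := cardsD (clusters W) (touched W x).
rewrite (setIidPr sT) => E; have := subset_leq_card sT.
move: H; rewrite E; case: (_ \notin _) => /=; lia.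
Qed.

(** Induction on the number of added vertices: each touches at least one cluster, so it cannot raise
    the count. *)
Lemma clusters_antitone W W' : W \subset W' -> #|clusters W'| <= #|clusters W|.
Proof.
move: {2}_.+1 (ltnSn #|W' :\: W|) => m; elim: m W' => // m IH W' sz sW.
have [/eqP|/set0Pn[x]] := eqVneq (W' :\: W) set0.
  rewrite setD_eq0 => sW'; suff -> : W = W' by [].
  by apply/eqP; rewrite eqEsubset sW.
rewrite inE => /andP[xW xW']; have xD : x \notin W' :\ x by rewrite !inE eqxx.
apply: leq_trans (IH (W' :\ x) _ _).
- have := card_clusters_add xD; rewrite setD1K // => H.
  have := touched_gt0 (W' :\ x) x; lia.
- move: sz; rewrite (cardsD1 x) !inE xW xW' /= add1n ltnS.
  by rewrite !setDDl setUC.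
- apply/subsetP => y yW; rewrite !inE (subsetP sW) // andbT.
  by apply: contraNneq xW => <-.
Qed.

Lemma clusters_gt0 W x : 0 < #|clusters W|.
Proof.
apply: leq_trans (touched_gt0 W x) (subset_leq_card _).
by apply/subsetP => b; rewrite inE => /andP[].
Qed.

Lemma card_clusters_le W : #|clusters W| <= #|V|.
Proof. exact: leq_trans (leq_imset_card _ _) (max_card _). Qed.

(** A neighbor [x] of [u] touches [[set u]], and also either its own singleton or the cluster of a
    neighbor in [W]. *)
Lemma adj_sub_bridges W u : u \notin W -> (forall y, y \in W -> ~~ G u y) ->
  [set x | G u x] \subset bridges W [set u].
Proof.
move=> uW NuW; apply/subsetP => x; rewrite inE => ux.
have uA : u \in anchors W.
  by rewrite inE; apply/orP; right; apply/forallP => y; apply/implyP/NuW.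
have uT : [set u] \in touched W x.
  by rewrite -(cluster_out uW); apply: touched_adj; rewrite // adj_sym.
have xW : x \notin W by apply/negP => /NuW; rewrite ux.
have nux : x != u by apply: contraTneq ux => ->; rewrite adj_irr.
rewrite inE xW uT /=; apply/card_gt1P.
case: (boolP (x \in anchors W)) => [xA|].
  exists [set u], [set x]; split => //; first by rewrite -(cluster_out xW) touched_self.
  by apply/eqP => /setP/(_ x); rewrite !inE eqxx (negbTE nux).
rewrite inE negb_or => /andP[_ /forallPn[y]]; rewrite negb_imply negbK.
move=> /andP[yW xy]; exists [set u], (cluster W y); split => //.
  by apply: touched_adj; rewrite // inE yW.
apply/eqP => /setP/(_ u); rewrite inE eqxx => /esym uy.
by move/negP: uW; apply; exact: subsetP (cluster_subset yW) _ uy.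
Qed.

Lemma in_bridges W b x : x \in bridges W b =
  [&& x \notin W, b \in touched W x & 1 < #|touched W x|].
Proof. by rewrite /bridges in_set. Qed.

Lemma in_prebridges W b x : x \in prebridges W b =
  [&& x \notin W, b \subset W, touched W x == [set b] &
      [exists y, prebridge_via W b x y]].
Proof. by rewrite /prebridges in_set. Qed.

Lemma card_bridges_prebridges W b : 1 < #|clusters W| -> b \in clusters W ->
  node_connectivity G <= #|bridges W b| + #|prebridges W b|.
Proof.
move=> gt1 bC; case: (clusters_sub_or_singleton bC); last first.
  case=> u [-> uW NuW]; apply: leq_trans (leq_addr _ _).
  apply: leq_trans (node_connectivity_le_degree u) (subset_leq_card _).
  exact: adj_sub_bridges.
case=> bW [x0 x0b]; apply: leq_trans (leq_card_setU _ _).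
set S := _ :|: _.
(* [X] collects the vertices that touch only [b] and are not prebridges; [b :|: X] is one side of
   the separation by [S], and [z] lies on the other. *)
pose X := [set x | (x \notin W) && (touched W x == [set b])] :\: prebridges W b.
have inX x : (x \in X) =
    [&& x \notin prebridges W b, x \notin W & touched W x == [set b]].
  by rewrite /X in_setD in_set.
have inS x : (x \in S) = (x \in bridges W b) || (x \in prebridges W b).
  by rewrite in_setU.
have [b' b'C nb] : exists2 b', b' \in clusters W & b' != b.
  case/card_gt1P: gt1 => c [d [cC dC ncd]].
  by case: (eqVneq c b) ncd => [->|? _]; [exists d; rewrite // eq_sym|exists c].
case/imsetP: (b'C) => z zA b'E.
have b'z : b' \in touched W z by rewrite b'E touched_self.
have nbz : touched W z != [set b].
  by apply: contraNneq nb => tE; move: b'z; rewrite tE in_set1.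
have zb : z \notin b.
  by apply: contra nb => zb; rewrite (clusters_eq bC zb) b'E.
have bT t : t \notin W -> b \in touched W t -> t \in (b :|: X) :|: S.
  move=> tW bt; rewrite !in_setU inX in_bridges tW bt /=.
  case: leqP => [le1|]; last by rewrite !orbT.
  have -> : touched W t == [set b].
    by rewrite eq_sym eqEcard sub1set bt cards1.
  by case: (t \in prebridges W b); rewrite ?orbT.
apply: (@node_connectivity_separator (b :|: X) S x0 z).
- by rewrite in_setU x0b.
- rewrite disjoint_subset; apply/subsetP => x /setUP[xb|].
    by rewrite inE inS in_bridges in_prebridges (subsetP bW).
  rewrite inX => /and3P[/negbTE xP _ /eqP tE].
  by rewrite inE inS in_bridges xP tE cards1 !andbF.
- by rewrite in_setU inX (negbTE zb) (negbTE nbz) !andbF.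
- rewrite inS in_bridges in_prebridges (negbTE nbz) /= !andbF orbF.
  case: (boolP (z \in W)) => //= zW; rewrite negb_and; apply/orP; left.
  rewrite inE bC /=; apply/existsPn => y; rewrite negb_and -implybE.
  apply/implyP => yb.
  have yW := subsetP bW _ yb; rewrite negb_or; apply/andP; split.
    by apply: contraNneq zW => <-.
  by move: zA; rewrite inE (negbTE zW) => /forallP/(_ y); rewrite yW.
- move=> s t /setUP[sb|sX] st; case: (boolP (t \in W)) => tW.
  + have sW := subsetP bW _ sb; rewrite !in_setU.
    have -> // : t \in b; rewrite (clusters_eq bC sb).
    by rewrite (cluster_step (mem_cluster W s) sW tW st).
  + apply: bT => //; rewrite (clusters_eq bC sb); apply: touched_adj.
      by rewrite inE (subsetP bW).
    by rewrite adj_sym.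
  + move: sX; rewrite inX => /and3P[_ _ /eqP sE].
    have : cluster W t \in touched W s by apply: touched_adj; rewrite // inE tW.
    by rewrite sE in_set1 => /eqP <-; rewrite !in_setU mem_cluster.
  (* A neighbor [t] outside [W] of a vertex [s] of [X] touches [b], since otherwise [t] would make
     [s] a prebridge. *)
  + apply: bT => //; apply: contraTT sX => bt; rewrite inX in_prebridges bW /=.
    case: (s \in W); rewrite ?andbF //=; case: eqP; rewrite ?andbF //= => _.
    rewrite andbT negbK; apply/existsP; exists t.
    by rewrite /prebridge_via tW st.
Qed.

(** * From a prebridge of [b] to a bridge of [x |: b] *)

Section Prebridge.
Variables (W b : {set V}) (x y : V).
Hypothesis bC : b \in clusters W.
Hypothesis xP : x \in prebridges W b.
Hypothesis yV : prebridge_via W b x y.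

(** [x] has a neighbor in [b] and touches no other cluster, so adding it extends [b] by [x]
    alone. *)
Lemma cluster_prebridge : cluster (x |: W) x = x |: b.
Proof.
move: xP; rewrite in_prebridges => /and4P[xW bW /eqP tE _].
have xT : b \in touched W x by rewrite tE in_set1.
apply/eqP; rewrite eqEsubset; apply/andP; split.
  apply/subsetP => z; rewrite inE; apply: connect_stable; last by rewrite !inE eqxx.
  move=> s t sxb; rewrite adj_minusC => /and3P[st sW'].
  rewrite !in_setU1; case: eqP => //= _ tW; move: sxb; rewrite in_setU1.
  case/orP => [/eqP sx|sb]; last first.
    rewrite (clusters_eq bC sb); apply: cluster_step st => //.
      exact: mem_cluster.
    exact: subsetP sb.
  have : cluster W t \in touched W x.
    by apply: touched_adj; rewrite -?sx // inE tW.
  by rewrite tE in_set1 => /eqP <-; exact: mem_cluster.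
move: xT; rewrite inE => /andP[_ /existsP[s /andP[sb]]].
have sW := subsetP bW _ sb.
case/orP => [/eqP sx|xs]; first by rewrite -sx sW in xW.
have sx' : s \in cluster (x |: W) x.
  by apply: cluster_step xs; rewrite ?mem_cluster // !inE ?eqxx // sW orbT.
apply/subsetP => t; rewrite in_setU1 => /orP[/eqP->|]; first exact: mem_cluster.
rewrite (eq_cluster sx') (clusters_eq bC sb) !inE; apply: connect_sub => u v.
rewrite adj_minusC => /and3P[uv uW vW]; apply: connect1.
by rewrite adj_minusC uv !inE uW vW !orbT.
Qed.

Lemma prebridge_clusters : x |: b \in clusters (x |: W).
Proof. by rewrite -cluster_prebridge clusters_in // !inE eqxx. Qed.

(** As [y] does not touch [b], only [x] is left; this recovers [x] from [x |: b] and [y]. *)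
Lemma prebridge_via_unique z : z \in x |: b -> G y z -> z = x.
Proof.
rewrite in_setU1 => /orP[/eqP//|zb] yz.
case/and3P: yV => _ _ /negP[]; rewrite inE bC /=.
by apply/existsP; exists z; rewrite zb yz orbT.
Qed.

Lemma prebridge_via_bridge : y \in bridges (x |: W) (x |: b).
Proof.
move: xP; rewrite in_prebridges => /and4P[xW bW /eqP tE _].
case/and3P: yV => yW xy ybT.
have nxy : y != x by apply: contraTneq xy => ->; rewrite adj_irr.
have yb : y \notin b by apply: contra yW; exact: subsetP.
have xT : x |: b \in touched (x |: W) y.
  rewrite -cluster_prebridge; apply: touched_adj; rewrite 1?adj_sym //.
  by rewrite !inE eqxx.
rewrite in_bridges xT in_setU1 (negbTE nxy) yW /=.
(* Were [y] an anchor, [x] would touch the cluster of [y], which is not [b]. So [y] has a neighbor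
   in [W], which gives the second touched cluster. *)
have : y \notin anchors W.
  apply/negP => yA; have := touched_adj yA xy; rewrite tE in_set1 => /eqP bE.
  by move: yb; rewrite -bE mem_cluster.
rewrite inE negb_or => /andP[_ /forallPn[z]]; rewrite negb_imply negbK.
move=> /andP[zW yz]; apply/card_gt1P.
exists (x |: b), (cluster (x |: W) z); split => //.
  by apply: touched_adj; rewrite // !inE zW orbT.
apply/eqP => E; have : z \in x |: b by rewrite E mem_cluster.
by move/prebridge_via_unique => /(_ yz) zx; rewrite -zx zW in xW.
Qed.

End Prebridge.

(** Two components of the graph on [~: S] are two of its clusters, and shrinking [~: S] to [W]
    cannot lower the count. *)
Lemma clusters_node_cut S W : W \subset ~: S -> node_cut G S ->
  1 < #|clusters W| \/ #|W| <= 1.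
Proof.
move=> WS /node_cut_inv[[x [y [xS yS nxy]]]|S1]; last first.
  by right; rewrite -S1 subset_leq_card.
left; apply: leq_trans (clusters_antitone WS); apply/card_gt1P.
exists (cluster (~: S) x), (cluster (~: S) y).
split; try by apply: clusters_in; rewrite inE.
apply/eqP => /setP/(_ y); rewrite mem_cluster inE setCK.
by rewrite (negbTE nxy).
Qed.

End Cut.

Local Open Scope ring_scope.

(** * Expectations over random vertex subsets *)

Section SubsetSums.
Variables (R : realType) (V : finType).
Implicit Types (W : {set V}) (f : {set V} -> R) (p : R).

Definition weight p W : R := p ^+ #|W| * (1 - p) ^+ #|~: W|.

Lemma weight_ge0 p W : 0 <= p <= 1 -> 0 <= weight p W.
Proof. by case/andP => p0 p1; rewrite mulr_ge0 ?exprn_ge0 ?subr_ge0. Qed.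

Lemma card_setC_add W x : x \notin W -> #|~: W| = #|~: (x |: W)|.+1.
Proof.
move=> xW; rewrite (cardsD1 x (~: W)) inE xW add1n; congr _.+1.
by apply: eq_card => y; rewrite !inE negb_or.
Qed.

Lemma weight_add p W x : x \notin W ->
  p * weight p W = (1 - p) * weight p (x |: W).
Proof.
by move=> xW; rewrite /weight cardsU1 xW (card_setC_add xW) add1n !exprS; ring.
Qed.

Lemma sum_mem_add (g : {set V} -> V -> R) :
  \sum_(W : {set V}) \sum_(x in W) g W x = \sum_(W : {set V}) \sum_(x | x \notin W) g (x |: W) x.
Proof.
rewrite !pair_big_dep /=.
rewrite (reindex_onto (fun u : {set V} * V => (u.2 |: u.1, u.2))
                      (fun u => (u.1 :\ u.2, u.2))) /=; last first.
  by case=> W x /= xW; rewrite setD1K.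
apply: eq_bigl => -[W x] /=; rewrite !inE eqxx /= xpair_eqE eqxx andbT.
apply/eqP/idP => [<-|xW]; first by rewrite !inE eqxx.
by rewrite setU1K.
Qed.

(** The expectation of [f] as a polynomial in the retention probability, so that it can be
    differentiated algebraically. *)
Definition mean_poly f : {poly R} :=
  \sum_(W : {set V}) (f W) *: ('X ^+ #|W| * (1 - 'X) ^+ #|~: W|).

Lemma mean_polyE f p : (mean_poly f).[p] = \sum_(W : {set V}) weight p W * f W.
Proof.
rewrite horner_sum; apply: eq_bigr => W _.
by rewrite !hornerE /= /weight; ring.
Qed.

(** Russo's formula, multiplied by [1 - p] to avoid a division. Reindexing by [sum_mem_add] reduces
    it to comparing the coefficients of each [f W]. *)
Lemma deriv_mean_poly f p : (1 - p) * (mean_poly f)^`().[p] =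
  \sum_(W : {set V}) weight p W * \sum_(x | x \notin W) (f (x |: W) - f W).
Proof.
under [RHS]eq_bigr do rewrite mulr_sumr.
under [RHS]eq_bigr => W _ do under eq_bigr do rewrite mulrBr.
under [RHS]eq_bigr do rewrite sumrB.
rewrite sumrB; set A := \sum_(W : {set V}) _.
have -> : A = \sum_(W : {set V}) \sum_(x in W) p ^+ #|W|.-1 * ((1 - p) * (1 - p) ^+ #|~: W|) * f W.
  rewrite sum_mem_add; apply: eq_bigr => W _; apply: eq_bigr => x xW.
  by rewrite -exprS -(card_setC_add xW) cardsU1 xW.
rewrite -sumrB raddf_sum /= horner_sum mulr_sumr; apply: eq_bigr => W _.
rewrite !sumr_const.
have -> : #|[pred x | x \notin W]| = #|~: W| by apply: eq_card => x; rewrite !inE.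
rewrite derivZ derivM derivXn deriv_exp derivB derivC derivX !hornerE.
rewrite !hornerMn !hornerE /= /weight; case: #|~: W| => [|c].
  by rewrite !mulr0n expr0; ring.
by rewrite [c.+1.-1]/= exprS; ring.
Qed.

Lemma ler_sum_imset (I J : finType) (h : I -> J) (A : {pred I}) (B : {pred J})
    (F : J -> R) :
  {in A &, injective h} -> {in A, forall i, h i \in B} ->
  (forall j, 0 <= F j) -> \sum_(i in A) F (h i) <= \sum_(j in B) F j.
Proof.
move=> hinj hAB F0; rewrite -(big_imset F hinj).
rewrite [leRHS](bigID (mem (h @: A))) /= -[leLHS]addr0 lerD ?sumr_ge0 //.
rewrite le_eqVlt; apply/orP; left; apply/eqP; apply: eq_bigl => j.
by apply/idP/andP => [jA|[]//]; split => //; case/imsetP: jA => i iA ->; exact: hAB.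
Qed.

(** Expected numbers of pairs become weights of sets of triples [(W, b, x)], which an injection can
    compare. *)
Lemma sum_card_triples (w : {set V} -> R) (C : {set V} -> {set {set V}})
    (P : {set V} -> {set V} -> {set V}) :
  \sum_(W : {set V}) w W * \sum_(b in C W) #|P W b|%:R =
  \sum_(t in [pred t : {set V} * {set V} * V |
               (t.1.2 \in C t.1.1) && (t.2 \in P t.1.1 t.1.2)]) w t.1.1.
Proof.
rewrite (eq_bigr (fun W => \sum_(b in C W) w W * #|P W b|%:R)); last first.
  by move=> W _; rewrite mulr_sumr.
rewrite pair_big_dep /=.
rewrite (eq_bigr (fun u => \sum_(x in P u.1 u.2) w u.1)); last first.
  by move=> u _; rewrite sumr_const -[in RHS]mulr_natr.
by rewrite pair_big_dep /=.
Qed.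

End SubsetSums.

(** * The expected excess of clusters and its decay *)

Section Excess.
Variables (R : realType) (V : finType) (G : sgraph V).
Implicit Types (W b : {set V}) (x y : V) (p : R).

(** A vertex touching [t >= 2] clusters is counted [t] times as a bridge and lowers the number of
    clusters by at least [t - 1 >= t / 2]. *)
Lemma sum_bridges_le_drop W :
  (\sum_(b in clusters G W) #|bridges G W b| <=
   2 * \sum_(x | x \notin W) (#|clusters G W| - #|clusters G (x |: W)|))%N.
Proof.
have cardE b : #|bridges G W b| = (\sum_(x | x \notin W)
    ((b \in touched G W x) && (1 < #|touched G W x|)))%N.
  rewrite -sum1_card big_mkcond [RHS]big_mkcond /=; apply: eq_bigr => x _.
  by rewrite in_bridges; case: (x \in W) => //=; case: (_ && _).
rewrite (eq_bigr _ (fun b _ => cardE b)) exchange_big /= big_distrr /=.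
apply: leq_sum => x xW; have := card_clusters_add G xW.
case: (ltnP 1 #|touched G W x|) => [gt1 H|_ _]; last first.
  by rewrite big1 // => b _; rewrite andbF.
suff -> : (\sum_(b in clusters G W) ((b \in touched G W x) && true))%N =
    #|touched G W x|.
  move: gt1 H; move: #|touched G W x| #|clusters G W| #|clusters G (x |: W)|.
  by move=> t c d; lia.
rewrite -sum1_card big_mkcond [RHS]big_mkcond /=; apply: eq_bigr => b _.
rewrite andbT; case: ifP => bC; first by case: (b \in _).
by rewrite /touched in_set bC.
Qed.

Lemma sum_prebridges_le p : 0 <= p <= 1 ->
  p * \sum_(W : {set V})
        weight p W * \sum_(b in clusters G W) #|prebridges G W b|%:R <=
  (1 - p) * \sum_(W : {set V})
        weight p W * \sum_(b in clusters G W) #|bridges G W b|%:R.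
Proof.
move=> p01; have [p0 p1] := andP p01.
rewrite !sum_card_triples !mulr_sumr.
(* [via] fixes one witness [y] for each prebridge, so that [h] is a function. *)
pose via W b x := odflt x [pick y | prebridge_via G W b x y].
pose h (t : {set V} * {set V} * V) :=
  (t.2 |: t.1.1, t.2 |: t.1.2, via t.1.1 t.1.2 t.2).
set A := (X in \sum_(t in X) _ <= _); set B := (X in _ <= \sum_(t in X) _).
have viaP t : t \in A -> prebridge_via G t.1.1 t.1.2 t.2 (via t.1.1 t.1.2 t.2).
  rewrite inE in_prebridges => /and5P[_ _ _ _ /existsP[y yV]].
  by rewrite /via; case: pickP => [//|/(_ y)]; rewrite yV.
have AC t : t \in A -> t.1.2 \in clusters G t.1.1 by rewrite inE => /andP[].
have AP t : t \in A -> t.2 \in prebridges G t.1.1 t.1.2 by rewrite inE => /andP[].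
have AW t : t \in A -> t.2 \notin t.1.1.
  by move=> /AP; rewrite in_prebridges => /andP[].
have Ab t : t \in A -> t.2 \notin t.1.2.
  move=> tA; have := AP _ tA; rewrite in_prebridges => /and3P[tW bW _].
  by apply: contra tW; exact: subsetP.
rewrite (eq_bigr (fun t => (1 - p) * weight p (h t).1.1)); last first.
  by move=> t tA; rewrite (weight_add _ (AW _ tA)).
apply: (@ler_sum_imset _ _ _ h A B (fun t => (1 - p) * weight p t.1.1)).
(* Injectivity: once [x] is recovered from [y] and [x |: b], removing it gives back [W] and [b],
   since it lies in neither. *)
- move=> t t' tA tA' E.
  have [EW Eb Ey] : [/\ (h t).1.1 = (h t').1.1, (h t).1.2 = (h t').1.2 &
    (h t).2 = (h t').2] by rewrite E.
  have Ex : t.2 = t'.2.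
    apply: (prebridge_via_unique (AC _ tA') (viaP _ tA')).
      by rewrite /= in Eb; rewrite -Eb !inE eqxx.
    rewrite /= in Ey; rewrite -Ey adj_sym.
    by case/and3P: (viaP _ tA).
  move: (AW _ tA) (AW _ tA') (Ab _ tA) (Ab _ tA') Ex EW Eb.
  case: t {tA E Ey} => [[W b] x]; case: t' {tA'} => [[W' b'] x'] /=.
  move=> xW xW' xb xb' xx'; subst x' => EW Eb.
  by rewrite -(setU1K xW) EW -(setU1K xb) Eb !setU1K.
- move=> t tA; rewrite inE /=; apply/andP; split.
    exact: prebridge_clusters (AC _ tA) (AP _ tA).
  exact: prebridge_via_bridge (AC _ tA) (AP _ tA) (viaP _ tA).
- by move=> t; rewrite mulr_ge0 ?weight_ge0 // subr_ge0.
Qed.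

Definition excess W : R := #|clusters G W|%:R - 1.

Lemma excess_ge0 W x : 0 <= excess W.
Proof. by rewrite subr_ge0 ler1n (clusters_gt0 G W x). Qed.

Lemma connectivity_excess W : (node_connectivity G)%:R * excess W <=
  \sum_(b in clusters G W) #|bridges G W b|%:R +
  \sum_(b in clusters G W) #|prebridges G W b|%:R.
Proof.
rewrite /excess; case: (ltnP 1 #|clusters G W|) => [gt1|le1]; last first.
  apply: (@le_trans _ _ 0); last by rewrite addr_ge0 // sumr_ge0.
  by rewrite mulr_ge0_le0 // subr_le0 lern1.
apply: (@le_trans _ _ (\sum_(b in clusters G W) (node_connectivity G)%:R)).
  rewrite sumr_const -[leRHS]mulr_natr ler_wpM2l //.
  by rewrite lerBlDr lerDl.
rewrite -big_split /=; apply: ler_sum => b bC.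
by rewrite -natrD ler_nat card_bridges_prebridges.
Qed.

Lemma mean_excess_drift p : 0 <= p <= 1 ->
  p * (node_connectivity G)%:R * (mean_poly excess).[p] <=
  - 2 * ((1 - p) * (mean_poly excess)^`().[p]).
Proof.
move=> p01; have [p0 p1] := andP p01.
rewrite mean_polyE deriv_mean_poly.
set BS := \sum_(W : {set V})
        weight p W * \sum_(b in clusters G W) #|bridges G W b|%:R.
apply: (@le_trans _ _ BS).
  apply: (@le_trans _ _ (p * \sum_(W : {set V}) weight p W *
    (\sum_(b in clusters G W) #|bridges G W b|%:R +
     \sum_(b in clusters G W) #|prebridges G W b|%:R))).
    rewrite -mulrA ler_wpM2l // mulr_sumr; apply: ler_sum => W _.
    by rewrite mulrCA ler_wpM2l ?weight_ge0 // connectivity_excess.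
  under eq_bigr do rewrite mulrDr.
  rewrite big_split /= mulrDr.
  (* Bridges contribute [p * BS] and prebridges at most [(1 - p) * BS], together at most [BS]. *)
  apply: le_trans (lerD (lexx _) (sum_prebridges_le p01)) _.
  by rewrite -/BS -mulrDl addrCA subrr addr0 mul1r.
rewrite mulr_sumr; apply: ler_sum => W _.
rewrite mulrCA ler_wpM2l ?weight_ge0 //.
apply: (@le_trans _ _ (2 * \sum_(x | x \notin W)
   (#|clusters G W| - #|clusters G (x |: W)|)%N)%:R).
  by rewrite -natr_sum ler_nat sum_bridges_le_drop.
rewrite natrM natr_sum mulNr -mulrN ler_wpM2l // -sumrN.
apply: ler_sum => x xW; rewrite /excess natrB; last exact/clusters_antitone/subsetUr.
by lra.
Qed.

(** A Gronwall argument: the drift makes [g] nonincreasing on the unit interval, and at [0] the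
    random set is empty, with at most [#|V|] clusters. *)
Lemma mean_excess_decay p (v : V) : 0 <= p <= 1 ->
  (mean_poly excess).[p] <=
  #|V|%:R * expR (- ((node_connectivity G)%:R / 4 * p ^+ 2)).
Proof.
move=> p01; have [p0 p1] := andP p01.
set P := mean_poly excess; set c := (node_connectivity G)%:R / 4.
pose g (t : R) := P.[t] * expR (c * t ^+ 2).
have dg t : is_derive t (1 : R) g
    (P.[t] * (2 * c * t * expR (c * t ^+ 2)) + expR (c * t ^+ 2) * P^`().[t]).
  rewrite /g; apply: is_derive_eq.
  by rewrite /GRing.scale /=; ring.
have P_ge0 t : 0 <= t <= 1 -> 0 <= P.[t].
  move=> t01; rewrite mean_polyE sumr_ge0 // => W _.
  by rewrite mulr_ge0 ?weight_ge0 ?(excess_ge0 W v).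
have gp : g p <= g 0.
  apply: (@ler0_derive1_le_cc R g 0 1).
  - by move=> t _; apply: ex_derive.
  - move=> t; rewrite in_itv /= => /andP[t0 t1].
    rewrite derive1E (@derive_val _ _ _ _ _ _ _ (dg t)).
    have t01 : 0 <= t <= 1 by rewrite !ltW.
    have := mean_excess_drift t01; rewrite -/P.
    have -> : (node_connectivity G)%:R = 4 * c by rewrite /c; field.
    have c0 : 0 <= c by rewrite divr_ge0.
    have := P_ge0 t t01; move: P.[t] P^`().[t] => a d a0 H.
    suff : 2 * c * t * a + d <= 0.
      have := expR_gt0 (c * t ^+ 2); move: (expR _) => e e0 H1.
      rewrite -[leLHS]/(a * (2 * c * t * e) + e * d).
      have -> : a * (2 * c * t * e) + e * d = e * (2 * c * t * a + d) by ring.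
      by rewrite mulr_ge0_le0 // ltW.
    (* After multiplication by [1 - t] the drift inequality applies, because the first term is
       nonnegative and [1 - t <= 1]. *)
    rewrite -(pmulr_rle0 _ (x := 1 - t)) ?subr_gt0 //.
    have : 0 <= t * (c * t * a) by rewrite !mulr_ge0 // ltW.
    by nra.
  - apply: continuous_subspaceT => t.
    by apply/differentiable_continuous/derivable1_diffP; exact: ex_derive.
  - by rewrite in_itv /= p0.
  - by rewrite in_itv /= lexx ler01.
  - exact: p0.
rewrite expRN ler_pdivlMr ?expR_gt0 //.
apply: le_trans gp _; rewrite /g expr0n mulr0 expR0 mulr1 mean_polyE.
rewrite (bigD1 finset.set0) //= big1 => [|W W0]; last first.
  by rewrite /weight expr0n cards_eq0 (negbTE W0) !mul0r.
rewrite /weight cards0 expr0 subr0 expr1n !mul1r addr0 /excess lerBlDr.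
by rewrite (@le_trans _ _ #|V|%:R) ?ler_nat ?card_clusters_le // lerDl.
Qed.

End Excess.

(** * The probability that a fixed color set is a cut *)

Section ColorProb.
Variables (R : realType) (V : finType) (nc : nat).
Hypothesis nc_gt0 : (0 < nc)%N.
Implicit Types (T : {set 'I_nc}) (col : {ffun V -> 'I_nc}).

Lemma color_prob_ge0 (A : pred {ffun V -> 'I_nc}) : 0 <= color_prob R A.
Proof. by rewrite sumr_ge0 // => col _; rewrite prodr_ge0. Qed.

Lemma color_probT : color_prob R (fun _ : {ffun V -> 'I_nc} => true) = 1.
Proof.
rewrite /color_prob -(bigA_distr_bigA (fun _ _ => nc%:R^-1)) big1 // => v _.
by rewrite sumr_const card_ord -[LHS]mulr_natr mulVf // pnatr_eq0 -lt0n.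
Qed.

Lemma color_prob_predC (A : pred {ffun V -> 'I_nc}) :
  color_prob R A = 1 - color_prob R (predC A).
Proof. by rewrite -color_probT /color_prob [X in X - _](bigID A) /= addrK. Qed.

Lemma color_prob_sub (A B : pred {ffun V -> 'I_nc}) :
  (forall col, A col -> B col) -> color_prob R A <= color_prob R B.
Proof.
move=> AB; rewrite /color_prob [leRHS](bigID A) /= -[leLHS]addr0 lerD //.
  rewrite le_eqVlt; apply/orP; left; apply/eqP; apply: eq_bigl => col.
  by apply/idP/andP => [H|[]//]; split => //; exact: AB.
by rewrite sumr_ge0 // => col _; rewrite prodr_ge0.
Qed.

Lemma color_prob_exists (I : finType) (A : I -> pred {ffun V -> 'I_nc}) :
  color_prob R (fun col => [exists i, A i col]) <= \sum_i color_prob R (A i).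
Proof.
rewrite /color_prob.
under [leRHS]eq_bigr do rewrite big_mkcond /=.
rewrite exchange_big /= big_mkcond /=; apply: ler_sum => col _.
have w0 : 0 <= \prod_(v : V) nc%:R^-1 :> R by rewrite prodr_ge0.
case: existsP => [[i Ai]|_]; last by rewrite sumr_ge0 // => i _; case: ifP.
by rewrite (bigD1 i) //= Ai lerDl sumr_ge0 // => j _; case: ifP.
Qed.

(* The vertices whose color avoids [T] form a random subset in which each vertex
   is kept independently with probability [1 - #|T| / nc]. *)
Lemma sum_color_subset T (g : {set V} -> R) :
  \sum_(col : {ffun V -> 'I_nc})
     (\prod_(v : V) nc%:R^-1) * g (~: (col @^-1: T)) =
  \sum_(W : {set V}) weight (1 - #|T|%:R / nc%:R) W * g W.
Proof.
have nc0 : nc%:R != 0 :> R by rewrite pnatr_eq0 -lt0n.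
rewrite (partition_big (fun col : {ffun V -> 'I_nc} => ~: (col @^-1: T)) predT) //=.
apply: eq_bigr => W _.
rewrite (eq_bigr (fun col : {ffun V -> 'I_nc} => \prod_(v : V) nc%:R^-1 * g W));
  last by move=> col /eqP ->.
rewrite -mulr_suml; congr (_ * _).
(* That exactly the vertices of [W] avoid [T] is one condition per vertex, so its probability
   factors. *)
rewrite (eq_bigl (mem (family (fun v => [pred c | (c \notin T) == (v \in W)]))));
  last first.
  move=> col; apply/eqP/familyP => [<- v|H]; first by rewrite !inE.
  by apply/setP => v; have := H v; rewrite !inE => /eqP.
rewrite -(bigA_distr_big_dep _ (fun _ _ => nc%:R^-1)) /=.
rewrite (bigID (mem W)) /= /weight; congr (_ * _).
  rewrite -prodr_const; apply: eq_bigr => v vW.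
  rewrite sumr_const -[LHS]mulr_natr.
  have -> : #|[pred c | (c \notin T) == (v \in W)]| = (nc - #|T|)%N.
    rewrite -[X in (X - _)%N]card_ord -(cardC T) addKn.
    by apply: eq_card => c; rewrite !inE vW eqb_id.
  rewrite natrB; last by rewrite -[X in (_ <= X)%N]card_ord max_card.
  by field.
rewrite (eq_bigl (mem (~: W))) => [|v]; last by rewrite !inE.
rewrite -prodr_const; apply: eq_bigr => v /setCP/negP vW.
rewrite sumr_const -[LHS]mulr_natr.
have -> : #|[pred c | (c \notin T) == (v \in W)]| = #|T|.
  by apply: eq_card => c; rewrite !inE (negbTE vW) eqbF_neg negbK.
by field.
Qed.

Variables (G : sgraph V) (v0 : V).

(** There are at most [#|V|.+1] such sets, each missing at least [k] vertices, hence of weight at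
    most [(1 - p) ^ k <= exp (- p k)]; and [p ^ 2 / 4 <= p]. *)
Lemma sum_weight_small (p : R) : 0 <= p <= 1 ->
  \sum_(W : {set V} | (#|W| <= 1)%N) weight p W <=
  #|V|.+1%:R * expR (- ((node_connectivity G)%:R / 4 * p ^+ 2)).
Proof.
move=> /andP[p0 p1].
have cardS : (#|[set W : {set V} | (#|W| <= 1)%N]| <= #|V|.+1)%N.
  apply: (@leq_trans #|finset.set0 |: [set [set v] | v : V]|); last first.
    rewrite cardsU1 -add1n leq_add ?leq_b1 //.
    by rewrite (leq_trans (leq_imset_card _ _)) ?max_card.
  apply/subset_leq_card/subsetP => W; rewrite !inE leq_eqVlt ltnS leqn0 cards_eq0.
  case/orP => [/cards1P[v ->]|->//]; apply/orP; right; exact: imset_f.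
apply: (@le_trans _ _ (\sum_(W in [set W : {set V} | (#|W| <= 1)%N])
    expR (- ((node_connectivity G)%:R / 4 * p ^+ 2)))); last first.
  rewrite sumr_const -[leLHS]mulr_natl ler_wpM2r ?expR_ge0 // ler_nat.
  exact: cardS.
rewrite (eq_bigl (mem [set W : {set V} | (#|W| <= 1)%N])) => [|W]; last by rewrite !inE.
apply: ler_sum => W; rewrite !inE => W1.
have kW : (node_connectivity G <= #|~: W|)%N.
  have := node_connectivity_ltn G v0; have := cardsC W.
  by move: #|W| W1 #|~: W| #|V| (node_connectivity G) => *; lia.
apply: (@le_trans _ _ (1 * (1 - p) ^+ node_connectivity G)).
  apply: ler_pM; rewrite ?exprn_ge0 ?subr_ge0 ?exprn_ile1 //.
  by apply: ler_wiXn2l; rewrite ?subr_ge0 // lerBlDr lerDl.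
rewrite mul1r; apply: (@le_trans _ _ (expR (- p) ^+ node_connectivity G)).
  by apply: lerXn2r; rewrite ?nnegrE ?subr_ge0 ?expR_ge0 //; exact: expR_ge1Dx.
rewrite -expRM_natl ler_expR mulrN lerN2 -mulrA ler_wpM2l //.
by nra.
Qed.

(** Markov's inequality for [g], which is at least 1 when [T] is a cut. The exact retention
    probability is [q], and [p] is a lower bound for it. *)
Lemma color_cut_prob T (p : R) : 0 <= p -> #|T|%:R <= (1 - p) * nc%:R ->
  color_prob R (fun col => color_node_cut G col T) <=
  (2 * #|V| + 1)%:R * expR (- ((node_connectivity G)%:R / 4 * p ^+ 2)).
Proof.
move=> p_ge0 Tp; set q : R := 1 - #|T|%:R / nc%:R.
have nc0 : 0 < nc%:R :> R by rewrite ltr0n.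
have pq : p <= q by rewrite /q lerBrDr -lerBrDl ler_pdivrMr.
have q01 : 0 <= q <= 1.
  by rewrite (le_trans p_ge0 pq) /q lerBlDr lerDl divr_ge0.
pose g (W : {set V}) : R := excess R G W + (#|W| <= 1)%N%:R.
apply: (@le_trans _ _ (\sum_(W : {set V}) weight q W * g W)).
  rewrite -sum_color_subset /color_prob big_mkcond /=; apply: ler_sum => col _.
  have w0 : 0 <= \prod_(v : V) nc%:R^-1 :> R by rewrite prodr_ge0.
  have e0 := excess_ge0 R G (~: (col @^-1: T)) v0.
  case: ifP => [/existsP[S /andP[cS sS]]|_]; last by rewrite mulr_ge0 // addr_ge0.
  rewrite -[leLHS]mulr1 ler_wpM2l // /g.
  have WS : ~: (col @^-1: T) \subset ~: S by rewrite setCS.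
  case: (clusters_node_cut WS cS) => [gt1|->]; last by rewrite lerDr.
  rewrite (le_trans _ (_ : excess R G (~: (col @^-1: T)) <= _)) ?lerDl //.
  by rewrite /excess lerBrDr -(natrD _ 1 1) ler_nat.
rewrite /g; under eq_bigr do rewrite mulrDr.
rewrite big_split /= -mean_polyE.
have -> : (2 * #|V| + 1)%N = (#|V| + #|V|.+1)%N by lia.
rewrite natrD mulrDl; apply: (@le_trans _ _
  (#|V|%:R * expR (- ((node_connectivity G)%:R / 4 * q ^+ 2)) +
   #|V|.+1%:R * expR (- ((node_connectivity G)%:R / 4 * q ^+ 2)))).
  apply: lerD; first exact: mean_excess_decay.
  apply: le_trans (sum_weight_small q01); rewrite [leRHS]big_mkcond /=.
  by apply: ler_sum => W _; case: leqP; rewrite ?mulr1 ?mulr0.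
have E : expR (- ((node_connectivity G)%:R / 4 * q ^+ 2)) <=
         expR (- ((node_connectivity G)%:R / 4 * p ^+ 2)).
  rewrite ler_expR lerN2 ler_wpM2l ?divr_ge0 //.
  by apply: lerXn2r; rewrite ?nnegrE // (le_trans p_ge0 pq).
by apply: lerD; rewrite ler_wpM2l.
Qed.

Lemma color_cut_prob_family (I : finType) (T : I -> {set 'I_nc}) (p : R) :
  0 <= p -> (forall i, #|T i|%:R <= (1 - p) * nc%:R) ->
  color_prob R (fun col => [exists i, color_node_cut G col (T i)]) <=
  #|I|%:R *
    ((2 * #|V| + 1)%:R * expR (- ((node_connectivity G)%:R / 4 * p ^+ 2))).
Proof.
move=> p0 HT; apply: le_trans (color_prob_exists _) _.
rewrite mulr_natl -sumr_const.
by apply: ler_sum => i _; exact: color_cut_prob.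
Qed.

End ColorProb.

(** * Bounds on the minimum color node cut *)

Section MinColorCut.
Variables (R : realType) (V : finType) (G : sgraph V) (v0 : V) (nc : nat).
Hypothesis nc_gt0 : (0 < nc)%N.
Implicit Types (C T : {set 'I_nc}) (col : {ffun V -> 'I_nc}).

Lemma color_node_cut_sub col C T :
  C \subset T -> color_node_cut G col C -> color_node_cut G col T.
Proof.
move=> CT /existsP[S /andP[cS sS]]; apply/existsP; exists S; rewrite cS /=.
exact: subset_trans sS (preimsetS _ CT).
Qed.

(** The colors seen on a minimum node cut form a color node cut. *)
Lemma min_color_node_cut_le col :
  (min_color_node_cut G col <= minn (node_connectivity G) nc)%N.
Proof.
rewrite leq_min bigminn_le_default andbT.
have [S cS <-] := node_connectivity_attained G v0.
apply: leq_trans (leq_imset_card col _); apply: bigminn_le.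
apply/existsP; exists S; rewrite cS; apply/subsetP => v vS.
by rewrite inE imset_f.
Qed.

Section Grouping.
Variable m : nat.
Hypothesis m_gt0 : (0 < m)%N.

(* Grouping the colors modulo [m] replaces the union bound over all small color
   sets by one over the [2 ^ m] sets of groups. *)
Definition color_group (c : 'I_nc) : 'I_m := Ordinal (ltn_pmod c m_gt0).

(** A color is determined by its residue and its quotient modulo [m]. *)
Lemma card_color_group (U : {set 'I_m}) :
  (#|color_group @^-1: U| <= #|U| * (nc %/ m).+1)%N.
Proof.
pose h (c : 'I_nc) : 'I_m * 'I_(nc %/ m).+1 := (color_group c, inord (c %/ m)).
have hinj : injective h.
  move=> c d [Emod Ediv]; apply/val_inj; rewrite /= (divn_eq c m) (divn_eq d m) Emod.
  congr (_ * _ + _)%N; move/(congr1 val): Ediv => /=.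
  by rewrite !inordK // ltnS leq_div2r // ltnW.
rewrite -(card_imset _ hinj).
have -> : (#|U| * (nc %/ m).+1)%N = #|setX U [set: 'I_(nc %/ m).+1]|.
  by rewrite cardsX cardsT card_ord.
apply/subset_leq_card/subsetP => u /imsetP[c cU ->].
by rewrite !inE /= andbT; rewrite inE in cU.
Qed.

(** A cut of at most [m / 4] colors lies in at most [m / 4] groups, which hold at most
    [m / 4 * (nc / m + 1) <= nc / 2] colors; hence the retention probability [1 / 2]. *)
Lemma small_cut_prob : (m <= nc)%N ->
  color_prob R (fun col => (4 * min_color_node_cut G col <= m)%N) <=
  (2 ^ m)%:R * ((2 * #|V| + 1)%:R *
    expR (- ((node_connectivity G)%:R / 4 * 2^-1 ^+ 2))).
Proof.
move=> m_nc.
(* Oversized sets of groups are replaced by the empty set, so that every index meets the size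
   bound. *)
pose T (U : {set 'I_m}) : {set 'I_nc} :=
  if (4 * #|U| <= m)%N then color_group @^-1: U else finset.set0.
have TP U : #|T U|%:R <= (1 - 2^-1) * nc%:R :> R.
  have : (2 * #|T U| <= nc)%N.
    rewrite /T; case: ifP => [U4|_]; last by rewrite cards0.
    have := card_color_group U; have := leq_divM nc m.
    move: #|_ @^-1: _| #|U| U4 (nc %/ m)%N => t u; nia.
  by rewrite -(ler_nat R) natrM; lra.
have -> : (2 ^ m)%N = #|{set 'I_m}|.
  by rewrite -cardsT -powersetT card_powerset cardsT card_ord.
apply: le_trans (color_cut_prob_family nc_gt0 G v0 _ TP); last by rewrite invr_ge0.
apply: color_prob_sub => col small; apply/existsP.
(* Being below the default value [nc], the minimum comes from an actual color cut. *)
have /bigminn_attained[C cC CE] : (min_color_node_cut G col < nc)%N by lia.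
exists (color_group @: C); rewrite /T ifT.
  apply: color_node_cut_sub cC; apply/subsetP => c cC.
  by rewrite inE imset_f.
by rewrite (leq_trans _ small) // leq_mul2l /= /min_color_node_cut -CE leq_imset_card.
Qed.

End Grouping.

(** Without grouping, the union bound costs [2 ^ nc], which is affordable once [k] dominates
    [nc]. *)
Lemma large_cut_prob (eps : R) : 0 <= eps <= 1 ->
  color_prob R (fun col => (min_color_node_cut G col)%:R < (1 - eps) * nc%:R) <=
  (2 ^ nc)%:R * ((2 * #|V| + 1)%:R *
    expR (- ((node_connectivity G)%:R / 4 * eps ^+ 2))).
Proof.
case/andP => e0 e1.
pose T (U : {set 'I_nc}) : {set 'I_nc} :=
  if #|U|%:R <= (1 - eps) * nc%:R then U else finset.set0.
have TP U : #|T U|%:R <= (1 - eps) * nc%:R.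
  by rewrite /T; case: ifP => // _; rewrite cards0 mulr_ge0 // subr_ge0.
have -> : (2 ^ nc)%N = #|{set 'I_nc}|.
  by rewrite -cardsT -powersetT card_powerset cardsT card_ord.
apply: le_trans (color_cut_prob_family nc_gt0 G v0 e0 TP).
apply: color_prob_sub => col small; apply/existsP.
have /bigminn_attained[C cC CE] : (min_color_node_cut G col < nc)%N.
  rewrite -(ltr_nat R); apply: lt_le_trans small _.
  by rewrite ler_piMl // lerBlDr lerDl.
by exists C; rewrite /T ifT // CE ltW.
Qed.

End MinColorCut.

(** * Asymptotic estimates and the conclusion *)

Lemma union_bound_small (R : realType) (c : R) (m k n : nat) : (0 < n)%N ->
  m%:R <= c / 2 * k%:R -> ln n%:R <= c / 4 * k%:R ->
  (2 ^ m)%:R * ((2 * n + 1)%:R * expR (- (c * k%:R))) <= 3 * n%:R^-1.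
Proof.
move=> n0 mk lnk; have n0' : 0 < n%:R :> R by rewrite ltr0n.
(* Half of the exponent pays for [2 ^ m], since [2 <= e]. *)
have e2 : (2 ^ m)%:R <= expR (c / 2 * k%:R).
  apply: (@le_trans _ _ (expR m%:R)); last by rewrite ler_expR.
  rewrite -[m%:R]mulr1 expRM_natl natrX lerXn2r ?nnegrE ?expR_ge0 //.
  by have := expR_ge1Dx (1 : R); rewrite -(natrD _ 1 1).
(* The other half beats [n ^ 2], leaving [(2 n + 1) / n ^ 2 <= 3 / n]. *)
have en : expR (- (c / 2 * k%:R)) <= n%:R ^- 2.
  rewrite expRN lef_pV2 ?posrE ?exprn_gt0 ?expR_gt0 //.
  rewrite -[n%:R in leLHS]lnK ?posrE // -expRM_natl ler_expR.
  by lra.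
apply: (@le_trans _ _ (expR (c / 2 * k%:R) * ((2 * n + 1)%:R * expR (- (c * k%:R))))).
  by rewrite ler_wpM2r // mulr_ge0 ?expR_ge0.
rewrite mulrCA -expRD.
have -> : c / 2 * k%:R - c * k%:R = - (c / 2 * k%:R) by field.
apply: (@le_trans _ _ ((3 * n)%:R * n%:R ^- 2)).
  by apply: ler_pM; rewrite ?expR_ge0 // ler_nat; lia.
by rewrite natrM expr2 invfM mulrA mulfK // lt0r_neq0.
Qed.

Local Open Scope classical_set_scope.
Local Open Scope ring_scope.

Lemma little_omega_le (R : realType) (f g : nat -> R) (c : R) : 0 < c ->
  little_omega f g -> \forall n \near \oo, `|g n| <= c * `|f n|.
Proof. by move=> c0 /eqoP; apply. Qed.

Lemma whp_of_bound (R : realType) (nc : nat -> nat)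
    (A : forall n, pred {ffun 'I_n -> 'I_(nc n)}) :
  (forall n, (0 < nc n)%N) ->
  (\forall n \near \oo, color_prob R (predC (A n)) <= 3 * n%:R^-1) ->
  whp R A.
Proof.
move=> nc_gt0 bound; rewrite /whp.
have lim : (fun n => 1 - 3 * n%:R^-1 : R) @ \oo --> (1 : R).
  rewrite -[X in _ --> X]subr0 -[X in 1 - X](mulr0 3).
  apply: cvgB; first exact: cvg_cst.
  by apply: cvgM; [exact: cvg_cst|rewrite -cvg_shiftS; exact: cvg_harmonic].
apply: (@squeeze_cvgr _ _ _ _ (fun n => 1 - 3 * n%:R^-1) (fun=> 1)) => //.
  near=> n; rewrite color_prob_predC // lerD2l lerN2 gerBl color_prob_ge0 andbT.
  by near: n.
exact: cvg_cst.
Unshelve. all: by end_near.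
Qed.

Theorem theorem7 (R : realType) (k nc : nat -> nat)
    (nc_gt0 : forall n : nat, (0 < nc n)%N)
    (k_log : little_omega (fun n : nat => (k n)%:R : R)
                          (fun n : nat => ln (n%:R : R))) :
  (exists c1 c2 : R, 0 < c1 /\ 0 < c2 /\
    forall G : (forall n : nat, sgraph 'I_n),
      (\forall n \near \oo, node_connectivity (G n) = k n) ->
      whp R (fun n (col : {ffun 'I_n -> 'I_(nc n)}) =>
        (c1 * (minn (k n) (nc n))%:R <= (min_color_node_cut (G n) col)%:R) &&
        ((min_color_node_cut (G n) col)%:R <= c2 * (minn (k n) (nc n))%:R)))
  /\
  (little_omega (fun n : nat => (k n)%:R : R) (fun n : nat => (nc n)%:R : R) ->
    forall eps : R, 0 < eps ->
    forall G : (forall n : nat, sgraph 'I_n),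
      (\forall n \near \oo, node_connectivity (G n) = k n) ->
      whp R (fun n (col : {ffun 'I_n -> 'I_(nc n)}) =>
        (1 - eps) * (nc n)%:R <= (min_color_node_cut (G n) col)%:R)).
Proof.
have ln_le c : 0 < c -> \forall n \near \oo, ln (n%:R : R) <= c * (k n)%:R.
  move=> c0; near=> n.
  apply: le_trans (ler_norm _) _; rewrite -[(k n)%:R]ger0_norm //.
  by near: n; exact: little_omega_le.
split.
  (* At retention probability [1 / 2] the exponent is [k / 16], half of which must pay for [2 ^ m]:
     hence [m <= k / 32], and [128 = 4 * 32]. *)
  exists (128^-1), 1; split; first by rewrite invr_gt0.
  split => // G Gk; apply: whp_of_bound => //; near=> n.
  have n0 : (0 < n)%N by near: n; exact: nbhs_infty_gt.
  have kE : node_connectivity (G n) = k n by near: n.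
  have lnk : ln (n%:R : R) <= 16^-1 / 4 * (k n)%:R.
    by near: n; apply: ln_le; rewrite divr_gt0 ?invr_gt0.
  (* Once [n >= e], [lnk] gives [k >= 64], so there is at least one group. *)
  have k32 : (0 < k n %/ 32)%N.
    have : expR 1 <= n%:R :> R by near: n; exact: nbhs_infty_ger.
    move=> en; have ln1 : 1 <= ln (n%:R : R).
      by rewrite -[leLHS]expRK ler_ln ?posrE ?expR_gt0 ?ltr0n.
    rewrite divn_gt0 // -(ler_nat R); lra.
  pose m := minn (nc n) (k n %/ 32).
  have m_gt0 : (0 < m)%N by rewrite leq_min nc_gt0.
  have m_nc : (m <= nc n)%N by exact: geq_minl.
  apply: (@le_trans _ _ (color_prob R (fun col : {ffun 'I_n -> 'I_(nc n)} =>
      (4 * min_color_node_cut (G n) col <= m)%N))).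
    apply: color_prob_sub => col /=.
    have := min_color_node_cut_le (G n) (Ordinal n0) col; rewrite kE => le_min.
    rewrite mul1r ler_nat le_min andbT -ltNge ltr_pdivlMl // -natrM ltr_nat.
    rewrite /m; lia.
  apply: le_trans (small_cut_prob R (G n) (Ordinal n0) (nc_gt0 n) m_gt0 m_nc) _.
  rewrite card_ord kE.
  have -> : (k n)%:R / 4 * 2^-1 ^+ 2 = 16^-1 * (k n)%:R :> R by field.
  apply: union_bound_small => //.
  have : (32 * m <= k n)%N by rewrite /m; lia.
  by rewrite -(ler_nat R) natrM; lra.
move=> k_nc eps eps_gt0 G Gk.
(* Capping at 1 keeps the retention probability in range, and a smaller [eps] only strengthens the
   bound. *)
pose e := Num.min eps 1.
have e0 : 0 < e by rewrite lt_min eps_gt0 ltr01.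
have e1 : e <= 1 by rewrite ge_min lexx orbT.
have e2 : 0 < e ^+ 2 by rewrite exprn_gt0.
apply: whp_of_bound => //; near=> n.
have n0 : (0 < n)%N by near: n; exact: nbhs_infty_gt.
have kE : node_connectivity (G n) = k n by near: n.
have lnk : ln (n%:R : R) <= e ^+ 2 / 4 / 4 * (k n)%:R.
  by near: n; apply: ln_le; rewrite !divr_gt0.
have nck : (nc n)%:R <= e ^+ 2 / 4 / 2 * (k n)%:R.
  rewrite -[(nc n)%:R]ger0_norm // -[(k n)%:R]ger0_norm //.
  by near: n; apply: little_omega_le; rewrite ?divr_gt0.
apply: (@le_trans _ _ (color_prob R (fun col : {ffun 'I_n -> 'I_(nc n)} =>
    (min_color_node_cut (G n) col)%:R < (1 - e) * (nc n)%:R))).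
  apply: color_prob_sub => col /=; rewrite -ltNge => H.
  by apply: lt_le_trans H _; rewrite ler_wpM2r // lerD2l lerN2 ge_min lexx.
apply: le_trans (large_cut_prob (G n) (Ordinal n0) (nc_gt0 n) _) _.
  by rewrite ltW.
rewrite card_ord kE.
have -> : (k n)%:R / 4 * e ^+ 2 = e ^+ 2 / 4 * (k n)%:R by field.
exact: union_bound_small.
Unshelve. all: by end_near.
Qed.
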